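(* Let $E: y^2=x^3+ax^2+bx+c$ ($a,b,c\in\mathbb{Z}$) be an elliptic curve and $P\in E(\mathbb{Q})$ a point of infinite order. For every $k\ge1$, the number $\tau_k=\frac{2n_{k-1}}{F_k(E,P)}$ is an integer.
   Context: An elliptic curve is a non-singular cubic $y^2=x^3+ax^2+bx+c$ with $a,b,c\in\mathbb{Z}$. For $k\ge0$ write $2^kP=\left(\frac{m_k}{e_k^2},\frac{n_k}{e_k^3}\right)$ with $m_k,n_k,e_k\in\mathbb{Z}$, $e_k\ge1$, $\gcd(m_k,e_k)=\gcd(n_k,e_k)=1$. Define $F_0(E,P)=e_0$ and $F_k(E,P)=e_k/e_{k-1}$ for $k\ge1$. *)

(* Defs.v *)
From HB Require Import structures.
From mathcomp Require Import all_boot all_order all_algebra all_field.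
From mathcomp Require Import ring.
Set Implicit Arguments.
Unset Strict Implicit.
Unset Printing Implicit Defensive.
Import Order.TTheory GRing.Theory Num.Theory.
Local Open Scope ring_scope.

Section ChordTangent.
Variable K : fieldType.
Implicit Types (a b c x y l : K).

(* [None] is the point at infinity, the neutral element. *)
Definition point := option (K * K).
Definition on_curve a b c (p : point) : bool :=
  if p is Some (x, y) then y ^+ 2 == x ^+ 3 + a * x ^+ 2 + b * x + c else true.
Definition opp_pt (p : point) : point :=
  if p is Some (x, y) then Some (x, - y) else None.
Definition slope a b x1 y1 x2 y2 :=
  if x1 == x2 then (3 * x1 ^+ 2 + 2 * a * x1 + b) / (2 * y1)
  else (y2 - y1) / (x2 - x1).
(* The reflection of the third intersection point of the curve with the line of
   slope l through (x1, y1) and (x2, _). *)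
Definition third a l x1 y1 x2 : point :=
  let x3 := l ^+ 2 - a - x1 - x2 in Some (x3, l * (x1 - x3) - y1).
Definition add_pt a b (p q : point) : point :=
  match p, q with
  | None, _ => q
  | _, None => p
  | Some (x1, y1), Some (x2, y2) =>
    if (x1 == x2) && (y1 == - y2) then None
    else third a (slope a b x1 y1 x2 y2) x1 y1 x2
  end.

Variables (a b c : K).
Hypothesis h2 : 2 != 0 :> K.
(* A point of the form (x, 0) is nonsingular; over a field of characteristic
   other than 2 these are the only possible singular points. *)
Hypothesis hns : forall x, x ^+ 3 + a * x ^+ 2 + b * x + c = 0 ->
  3 * x ^+ 2 + 2 * a * x + b != 0.
Local Notation "p (+) q" := (add_pt a b p q).
Local Notation cur := (on_curve a b c).

(* l is the slope of the chord through, or the tangent at, the two points: the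
   second equation is the first one multiplied by (y1 + y2) / (x2 - x1). *)
Definition good l x1 y1 x2 y2 :=
  (y2 = y1 + l * (x2 - x1)) /\
  (b = l * (y1 + y2) - x1 ^+ 2 - x1 * x2 - x2 ^+ 2 - a * (x1 + x2)).

Lemma eq0_sub (x y : K) : x - y = 0 -> x = y.
Proof. by move/eqP; rewrite subr_eq0 => /eqP. Qed.

Lemma same_x x y y' : cur (Some (x, y)) -> cur (Some (x, y')) ->
  (y == y') || (y == - y').
Proof.
move=> /eqP h /eqP h'; rewrite -eqf_sqr; apply/eqP; by rewrite h h'.
Qed.

Lemma good_slope x1 y1 x2 y2 : cur (Some (x1, y1)) -> cur (Some (x2, y2)) ->
  ~~ ((x1 == x2) && (y1 == - y2)) -> good (slope a b x1 y1 x2 y2) x1 y1 x2 y2.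
Proof.
move=> h1 h2' no; rewrite /good /slope.
case: eqVneq no h2' => [<- /= no h2'|ne _ h2'].
  have e : y1 = y2.
    by have := same_x h1 h2'; rewrite (negbTE no) orbF => /eqP.
  subst y2; have y0 : y1 != 0.
    by apply: contraNneq no => ->; rewrite oppr0.
  split; first by ring.
  by field; rewrite h2 y0.
have ne' : x2 - x1 != 0 by rewrite subr_eq0 eq_sym.
split; first by field.
apply: (mulfI ne').
move: h1 h2' => /eqP h1 /eqP h3.
have -> : (x2 - x1) * ((y2 - y1) / (x2 - x1) * (y1 + y2) - x1 ^+ 2 - x1 * x2 - x2 ^+ 2 -
   a * (x1 + x2)) = y2 ^+ 2 - y1 ^+ 2 - (x2 - x1) * (x1 ^+ 2 + x1 * x2 + x2 ^+ 2 +
   a * (x1 + x2)) by field.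
rewrite h1 h3; ring.
Qed.

Lemma slope_uniq x1 y1 x2 y2 l l' : 
  ~~ ((x1 == x2) && (y1 == - y2)) -> good l x1 y1 x2 y2 -> good l' x1 y1 x2 y2 ->
  l = l'.
Proof.
move=> no [e1 e2] [e1' e2'].
have z1 : (l - l') * (x2 - x1) = 0.
  have -> : (l - l') * (x2 - x1) = (y1 + l * (x2 - x1)) - (y1 + l' * (x2 - x1)) by ring.
  by rewrite -e1 -e1' subrr.
have z2 : (l - l') * (y1 + y2) = 0.
  transitivity (b - b); last exact: subrr.
  by rewrite {1}e2 e2'; ring.
apply: eq0_sub; apply/eqP; apply: contraNT no => ne.
move/eqP: z1; move/eqP: z2; rewrite !mulf_eq0 !(negbTE ne) /= subr_eq0 addr_eq0.
by move=> -> /eqP ->; rewrite eqxx.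
Qed.

Lemma addE x1 y1 x2 y2 l : cur (Some (x1, y1)) -> cur (Some (x2, y2)) ->
  ~~ ((x1 == x2) && (y1 == - y2)) -> good l x1 y1 x2 y2 ->
  Some (x1, y1) (+) Some (x2, y2) = third a l x1 y1 x2.
Proof.
move=> h1 h3 no g; rewrite /add_pt (negbTE no).
by rewrite (slope_uniq no (good_slope h1 h3 no) g).
Qed.

Lemma cur_third x1 y1 x2 y2 l : cur (Some (x1, y1)) -> good l x1 y1 x2 y2 ->
  cur (third a l x1 y1 x2).
Proof.
move=> /eqP h1 [e1 e2]; apply/eqP.
have ec : c = y1 ^+ 2 - x1 ^+ 3 - a * x1 ^+ 2 - b * x1 by rewrite h1; ring.
by rewrite ec e2 e1; ring.
Qed.

Lemma cur_add p q : cur p -> cur q -> cur (p (+) q).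
Proof.
case: p q => [[x1 y1]|] [[x2 y2]|] // h1 h3 ; rewrite /add_pt.
case: ifPn => // no; exact: cur_third h1 (good_slope h1 h3 no).
Qed.

Lemma cur_opp p : cur p -> cur (opp_pt p).
Proof. by case: p => [[x y]|] //=; rewrite sqrrN. Qed.

Lemma oppK p : opp_pt (opp_pt p) = p.
Proof. by case: p => [[x y]|] //=; rewrite opprK. Qed.

Lemma addC p q : cur p -> cur q -> p (+) q = q (+) p.
Proof.
case: p q => [[x1 y1]|] [[x2 y2]|] // h1 h3.
case no : ((x1 == x2) && (y1 == - y2)).
  have no' : (x2 == x1) && (y2 == - y1).
    by case/andP: no => /eqP -> /eqP ->; rewrite opprK !eqxx.
  by rewrite /add_pt no no'.
have no' : ~~ ((x2 == x1) && (y2 == - y1)).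
  by apply: contraFN no; case/andP=> /eqP -> /eqP ->; rewrite opprK !eqxx.
have g := good_slope h1 h3 (negbT no); move: (slope _ _ _ _ _ _) g => l g.
have g' : good l x2 y2 x1 y1.
  by case: g => e1 e2; split; rewrite ?e2 e1; ring.
rewrite (addE h1 h3 (negbT no) g) (addE h3 h1 no' g').
by case: g => e1 _; rewrite /third e1; congr (Some (_, _)); ring.
Qed.

Lemma addN p : opp_pt p (+) p = None.
Proof. by case: p => [[x y]|] //=; rewrite !eqxx. Qed.

Lemma add_eq0 p q : p (+) q = None -> p = opp_pt q.
Proof.
case: p q => [[x1 y1]|] [[x2 y2]|] //=.
by case: ifP => // /andP[/eqP -> /eqP ->].
Qed.

Lemma opp_add p q : cur p -> cur q ->
  opp_pt (p (+) q) = opp_pt p (+) opp_pt q.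
Proof.
move=> hp hq; have hp' := cur_opp hp; have hq' := cur_opp hq.
case: p q hp hq hp' hq' => [[x1 y1]|] [[x2 y2]|] // h1 h3 h1' h3'.
case no : ((x1 == x2) && (y1 == - y2)).
  by rewrite /add_pt /= eqr_opp no.
have no' : ~~ ((x1 == x2) && (- y1 == - - y2)) by rewrite eqr_opp no.
have g := good_slope h1 h3 (negbT no); move: (slope _ _ _ _ _ _) g => l g.
have g' : good (- l) x1 (- y1) x2 (- y2).
  by case: g => e1 e2; split; rewrite ?e2 e1; ring.
rewrite (addE h1 h3 (negbT no) g) (addE h1' h3' no' g') /third /=.
by congr (Some (_, _)); ring.
Qed.

Lemma third_neq x1 y1 x2 y2 l : cur (Some (x1, y1)) -> 
  good l x1 y1 x2 y2 -> third a l x1 y1 x2 <> Some (x1, y1).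
Proof.
move=> h1 [e1 e2]; case=> ex; rewrite ex => ey.
have y0 : y1 = 0.
  have: 2 * y1 = 0.
    transitivity (y1 - (l * (x1 - x1) - y1)); first by ring.
    by rewrite ey subrr.
  by move/eqP; rewrite mulf_eq0 (negbTE h2) => /eqP.
have := hns (x := x1); move/eqP: (h1); rewrite y0 expr0n /= => <- /(_ erefl)/eqP; apply.
have ea : a = l ^+ 2 - 2 * x1 - x2.
  by transitivity (a + (l ^+ 2 - a - x1 - x2) - x1); [rewrite ex|]; ring.
by rewrite e2 e1 y0 ea; ring.
Qed.

Lemma addKp p q : cur p -> cur q -> opp_pt p (+) (p (+) q) = q.
Proof.
move=> hp hq; have hp' := cur_opp hp; have hr := cur_add hp hq.
case: p q hp hq hp' hr => [[x1 y1]|] [[x2 y2]|] //;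
  last by move=> h1 h3 h1' _; exact: (addN (Some (x1, y1))).
move=> h1 h3 h1' hr.
case no : ((x1 == x2) && (y1 == - y2)).
  rewrite {2}/add_pt no /=.
  by case/andP: no => /eqP -> /eqP ->; rewrite opprK.
have g := good_slope h1 h3 (negbT no); move: (slope _ _ _ _ _ _) g => l g.
move: hr; rewrite (addE h1 h3 (negbT no) g) => hr.
have nt := third_neq h1 g.
have := @addE x1 (- y1) _ _ (- l) h1' hr => /= ->.
- by case: g => e1 e2; rewrite /third e1; congr (Some (_, _)); ring.
- apply/negP => /andP[/eqP ex /eqP ey]; apply: nt; rewrite /third /=.
  by rewrite -ex in ey *; congr (Some (_, _)); exact/esym/oppr_inj.
- by case: g => e1 e2; split; rewrite ?e2 ?e1; ring.
Qed.

Lemma addKp' p q : cur p -> cur q -> p (+) (opp_pt p (+) q) = q.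
Proof. by move=> hp hq; rewrite -{1}[p]oppK addKp // cur_opp. Qed.

Lemma addpK p q : cur p -> cur q -> (q (+) p) (+) opp_pt p = q.
Proof.
move=> hp hq; have hr := cur_add hq hp; have hp' := cur_opp hp.
by rewrite [LHS]addC // [q (+) p]addC // addKp.
Qed.

Lemma addpK' p q : cur p -> cur q -> (q (+) opp_pt p) (+) p = q.
Proof. by move=> hp hq; rewrite -{2}[p]oppK addpK // cur_opp. Qed.

Lemma add_idl p q : cur p -> cur q -> p (+) q = p -> q = None.
Proof. by move=> hp hq e; rewrite -[q](addKp hp hq) e addN. Qed.

Lemma gen_x (x2 d g l u q : K) (A := q - 3 * x2 - d - g)
  (y2 := (q * (d - g) - l ^+ 2 * d + u ^+ 2 * g) / (2 * (l - u)))
  (x1 := x2 + d) (x3 := x2 + g) (y1 := y2 + l * d) (y3 := y2 + u * g)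
  (x4 := l ^+ 2 - A - x1 - x2) (y4 := l * (x1 - x4) - y1)
  (x5 := u ^+ 2 - A - x2 - x3) (y5 := u * (x2 - x5) - y2)
  (l4 := (y3 - y4) / (x3 - x4)) (l5 := (y5 - y1) / (x5 - x1)) :
  l != u -> q != l ^+ 2 -> q != u ^+ 2 ->
  third A l4 x4 y4 x3 = third A l5 x1 y1 x5.
Proof.
rewrite -[l == u]subr_eq0 -[q == l ^+ 2]subr_eq0 -[q == u ^+ 2]subr_eq0 => n1 n2 n3.
have e4 : x3 - x4 = q - l ^+ 2 by rewrite /x4 /x3 /x1 /A; ring.
have e5 : x5 - x1 = u ^+ 2 - q by rewrite /x5 /x3 /x1 /A; ring.
have n3' : u ^+ 2 - q != 0 by rewrite -oppr_eq0 opprB.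
rewrite /third /l4 /l5 e4 e5 /y5 /y4 /x5 /x4 /x3 /y3 /y1 /x1 /y2 /A.
congr (Some (_, _)).
  by field; rewrite h2 n1 n2 n3'.
by field; rewrite h2 n1 n2 n3'.
Qed.

Lemma dbl_x (x2 d g l u : K) (A := l ^+ 2 - d - g - 3 * x2)
  (y2 := - (g * (u + l)) / 2)
  (x1 := x2 + d) (x3 := x2 + g) (y1 := y2 + l * d) (y3 := - y2 - l * g)
  (B := l * (y1 + y2) - x1 ^+ 2 - x1 * x2 - x2 ^+ 2 - A * (x1 + x2))
  (x5 := u ^+ 2 - A - x2 - x3) (y5 := u * (x2 - x5) - y2)
  (t := (3 * x3 ^+ 2 + 2 * A * x3 + B) / (2 * y3))
  (l5 := (y5 - y1) / (x5 - x1)) :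
  g != 0 -> u ^+ 2 != l ^+ 2 ->
  third A l5 x1 y1 x5 = third A t x3 y3 x3.
Proof.
move=> g0; rewrite -subr_eq0 subr_sqr mulf_eq0 negb_or => /andP[n1 n2].
have e5 : x5 - x1 = (u - l) * (u + l) by rewrite /x5 /x3 /x1 /A; ring.
have e3 : 2 * y3 = g * (u - l) by rewrite /y3 /y2; field.
rewrite /third /l5 /t e5 e3 /y5 /B /x5 /y3 /x3 /y1 /x1 /y2 /A.
by congr (Some (_, _)); field; rewrite ?h2 ?n1 ?n2 ?g0.
Qed.

Lemma two_x (x2 d g l : K) (A := l ^+ 2 - d - g - 3 * x2)
  (x1 := x2 + d) (x3 := x2 + g) (y1 := l * d) (y3 := - (l * g))
  (B := l * y1 - x1 ^+ 2 - x1 * x2 - x2 ^+ 2 - A * (x1 + x2))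
  (t := (3 * x3 ^+ 2 + 2 * A * x3 + B) / (2 * y3))
  (v := (3 * x1 ^+ 2 + 2 * A * x1 + B) / (2 * y1)) :
  y1 != 0 -> y3 != 0 -> third A v x1 y1 x1 = third A t x3 y3 x3.
Proof.
rewrite oppr_eq0 !mulf_eq0 !negb_or => /andP[l0 d0] /andP[_ g0].
rewrite /third /v /t /B /y3 /x3 /y1 /x1 /A.
by congr (Some (_, _)); field; rewrite oppr_eq0 mulf_eq0 !negb_or ?h2 l0 d0 g0.
Qed.

Lemma addS x1 y1 x2 y2 : Some (x1, y1) (+) Some (x2, y2) =
  if (x1 == x2) && (y1 == - y2) then None
  else third a (slope a b x1 y1 x2 y2) x1 y1 x2.
Proof. by []. Qed.

Lemma eq_opp p q : cur p -> cur q -> 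
  if p is Some (x, _) then if q is Some (x', _) then
    x = x' -> p = q \/ p = opp_pt q else True else True.
Proof.
case: p q => [[x1 y1]|] [[x2 y2]|] // h1 h3 e; subst x2.
by case/orP: (same_x h1 h3) => /eqP ->; [left | right].
Qed.

Lemma add_dbl p q : cur p -> cur q ->
  p (+) q <> None -> q (+) (p (+) q) <> None ->
  (p (+) q) (+) (p (+) q) <> None ->
  p (+) (q (+) (p (+) q)) <> None -> q (+) (p (+) q) <> p ->
  p (+) (q (+) (p (+) q)) = (p (+) q) (+) (p (+) q).
Proof.
move=> hp hq; have hr := cur_add hp hq; have hs := cur_add hq hr.
have i1 : p (+) q = q -> p = None by rewrite addC //; exact: add_idl.
have := eq_opp hq hr; have := eq_opp hp hs.
case: p q hp hq hr hs i1 => [[x1 y1]|] [[x2 y2]|] // h1 h3 hr hs i1.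
have [no|no] := boolP ((x1 == x2) && (y1 == - y2)); first by rewrite addS no.
have gd := good_slope h1 h3 no.
have e3 := addE h1 h3 no gd.
move: (slope _ _ _ _ _ _) gd e3 => l gd e3.
have ey3 : l * (x1 - (l ^+ 2 - a - x1 - x2)) - y1 =
           l * (x2 - (l ^+ 2 - a - x1 - x2)) - y2 by rewrite gd.1; ring.
rewrite {}e3 /third {}ey3 in hr hs i1 *.
set x3 := l ^+ 2 - a - x1 - x2 in hr hs i1 *.
set y3 := l * (x2 - x3) - y2 in hr hs i1 *.
have [no2|no2] := boolP ((x2 == x3) && (y2 == - y3)); first by rewrite addS no2.
have [n23|n23] := eqVneq x2 x3.
  move=> _ /(_ n23) [e|[_ e]]; first by have := i1 (esym e).
  by move: no2; rewrite e n23 !eqxx.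
have e5 : Some (x2, y2) (+) Some (x3, y3) = third a ((y3 - y2) / (x3 - x2)) x2 y2 x3.
  by rewrite addS (negbTE no2) /slope (negbTE n23).
rewrite {}e5 in hs *.
set u := _ / _ in hs *; rewrite /third in hs *.
set x5 := u ^+ 2 - a - x2 - x3 in hs *.
set y5 := u * (x2 - x5) - y2 in hs *.
move=> j5 _ _ _; rewrite !addS eqxx /=.
have [//|n3] := eqVneq y3 (- y3).
have [//|no5] := boolP ((x1 == x5) && (y1 == - y5)).
rewrite /slope eqxx; have [e15|n15] := eqVneq x1 x5.
  move=> _ _ nn; have := same_x h1; rewrite e15 => /(_ _ hs).
  case/orP=> /eqP e; first by case: nn; rewrite e e15.
  by move: no5; rewrite e15 e !eqxx.
move=> _ _ _.
have g0 : x3 - x2 != 0 by rewrite subr_eq0 eq_sym.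
have := @dbl_x x2 (x1 - x2) (x3 - x2) l u g0.
have -> : l ^+ 2 - (x1 - x2) - (x3 - x2) - 3 * x2 = a by rewrite /x3; ring.
have -> : - ((x3 - x2) * (u + l)) / 2 = y2 by rewrite /u /y3; field; rewrite h2.
have -> : x2 + (x1 - x2) = x1 by ring.
have -> : x2 + (x3 - x2) = x3 by ring.
have -> : y2 + l * (x1 - x2) = y1 by rewrite gd.1; ring.
have -> : - y2 - l * (x3 - x2) = y3 by rewrite /y3; ring.
have -> : l * (y1 + y2) - x1 ^+ 2 - x1 * x2 - x2 ^+ 2 - a * (x1 + x2) = b by exact/esym/gd.2.
apply; apply: contra n15 => /eqP e; rewrite /x5 e; apply/eqP; rewrite /x3; ring.
Qed.

Lemma addA p q r : cur p -> cur q -> cur r ->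
  p (+) (q (+) r) = (p (+) q) (+) r.
Proof.
have a0 s : s (+) None = s by case: s => [[? ?]|].
have [->|pn] := eqVneq p None; first by [].
have [->|qn] := eqVneq q None; first by rewrite a0.
have [->|rn] := eqVneq r None; first by rewrite !a0.
move=> hp hq hr; have hpq := cur_add hp hq; have hqr := cur_add hq hr.
have hp' := cur_opp hp; have hq' := cur_opp hq; have hr' := cur_opp hr.
have [/add_eq0 e|n1] := eqVneq (p (+) q) None; first by rewrite e addN addKp.
have [/add_eq0 e|n2] := eqVneq (q (+) r) None.
  by rewrite e addN addpK' //; case: (p) => [[]|].
have [z3|n3] := eqVneq ((p (+) q) (+) r) None.
  have er : r = opp_pt q (+) opp_pt p.
    by rewrite addC // -opp_add // (add_eq0 z3) oppK.
  by rewrite z3 er addKp' // addC // addN.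
have [z4|n4] := eqVneq (p (+) (q (+) r)) None.
  have er : p = opp_pt r (+) opp_pt q.
    by rewrite addC // -opp_add // (add_eq0 z4).
  by rewrite z4 er addpK' // addN.
have [e|n5] := eqVneq r p.
  by rewrite e [q (+) p]addC // addC.
have [e|n6] := eqVneq r (opp_pt p).
  by rewrite e [q (+) _]addC // addKp' // [p (+) q]addC // addpK.
have [e|n7] := eqVneq (p (+) q) r.
  have [e'|n8] := eqVneq (q (+) r) p; last first.
    by rewrite -e in n2 n3 n4 n8 *; apply: add_dbl => //; exact/eqP.
  have q2 : q = opp_pt q.
    have e1 : opp_pt p (+) r = q by rewrite -e addKp.
    have e2 : q = p (+) opp_pt r by rewrite -{1}e' addpK.
    by rewrite {1}e2 -e1 opp_add // oppK.
  rewrite e e'; move: n3 n4; rewrite e e'.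
  case: p q r pn qn rn e e' q2 hp hq hr hpq {hp' hq' hr' hqr n1 n2 n5 n6} =>
    [[x1 y1]|] [[x2 y2]|] [[x3 y3]|] // _ _ _ e e' [q2] h1 h3 h4 _.
  have y0 : y2 = 0.
    have: 2 * y2 = 0 by transitivity (y2 - - y2); [ring | rewrite -q2 subrr].
    by move/eqP; rewrite mulf_eq0 (negbTE h2) => /eqP.
  subst y2; move: e; rewrite addS.
  have [//|no] := boolP ((x1 == x2) && (y1 == - 0)).
  have := good_slope h1 h3 no; move: (slope _ _ _ _ _ _) => l gd [ex ey].
  rewrite !addS !eqxx /=; have [//|n3] := eqVneq y3 _; have [//|n1] := eqVneq y1 _.
  move=> _ _; rewrite /slope !eqxx.
  have f1 : y1 = l * (x1 - x2).
    by apply: eq0_sub; transitivity (y1 + l * (x2 - x1)); [ring | exact/esym/gd.1].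
  have f3 : y3 = - (l * (x3 - x2)) by rewrite -ey ex f1; ring.
  have := @two_x x2 (x1 - x2) (x3 - x2) l; cbv zeta.
  have -> : l ^+ 2 - (x1 - x2) - (x3 - x2) - 3 * x2 = a by rewrite -ex; ring.
  have -> : x2 + (x1 - x2) = x1 by ring.
  have -> : x2 + (x3 - x2) = x3 by ring.
  rewrite -f1 -f3.
  have -> : l * y1 - x1 ^+ 2 - x1 * x2 - x2 ^+ 2 - a * (x1 + x2) = b.
    by rewrite gd.2; ring.
  apply.
    by apply: contraNneq n1 => ->; rewrite oppr0.
  by apply: contraNneq n3 => ->; rewrite oppr0.
have [e|n8] := eqVneq (q (+) r) p.
  have e' : r (+) q = p by rewrite addC.
  have -> : p (+) q = q (+) (r (+) q) by rewrite e' addC.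
  have nr : q (+) (r (+) q) <> r by rewrite e' addC //; exact/eqP.
  have hrq : cur (r (+) q) by rewrite e'.
  have hqrq := cur_add hq hrq.
  transitivity ((r (+) q) (+) (r (+) q)); first by rewrite e e'.
  rewrite -add_dbl //; first by rewrite addC.
  - by rewrite addC //; exact/eqP.
  - by rewrite e' addC //; exact/eqP.
  - by rewrite e' -{2}e; exact/eqP.
  - by rewrite e' addC // [q (+) p]addC //; exact/eqP.
have m7 : p (+) q <> opp_pt r by move=> E; move: n3; rewrite E addN.
have m8 : p <> opp_pt (q (+) r) by move=> E; move: n4; rewrite {1}E addN.
have := eq_opp hp hr; have := eq_opp hpq hr; have := eq_opp hp hqr.
have pr : p <> opp_pt r by move=> E; move: n6; rewrite E oppK eqxx.
move: n1 n2 n3 n4 n5 n7 n8 m7 m8 pr {n6 hp' hq' hr'}.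
move: hpq hqr.
case: p q r pn qn rn hp hq hr => [[x1 y1]|] [[x2 y2]|] [[x3 y3]|] // _ _ _ h1 h3 h4.
have [no|no] := boolP ((x1 == x2) && (y1 == - y2)); first by rewrite addS no.
have [no2|no2] := boolP ((x2 == x3) && (y2 == - y3)).
  by rewrite [Some (x2, y2) (+) _]addS no2.
have gd := good_slope h1 h3 no; have gd2 := good_slope h3 h4 no2.
rewrite (addE h1 h3 no gd) (addE h3 h4 no2 gd2).
move: (slope a b x1 y1 x2 y2) (slope a b x2 y2 x3 y3) gd gd2 => l u gd gd2.
rewrite /third.
set x4 := l ^+ 2 - a - x1 - x2; set y4 := l * (x1 - x4) - y1.
set x5 := u ^+ 2 - a - x2 - x3; set y5 := u * (x2 - x5) - y2.
move=> h5 h6 _ _ n3 n4 n5 n7 n8 m7 m8 pr i1 i2 i3.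
have d13 : x1 != x3.
  by apply/eqP => /i3[] E; [move: n5; rewrite E eqxx | case: pr].
have d43 : x4 != x3.
  by apply/eqP => /i2[] E; [move: n7; rewrite E eqxx | case: m7].
have d15 : x1 != x5.
  by apply/eqP => /i1[] E; [move: n8; rewrite E eqxx | case: m8].
rewrite !addS (negbTE d43) (negbTE d15) /= /slope (negbTE d43) (negbTE d15).
pose q := (l * (y1 + y2) - u * (y2 + y3)) / (x1 - x3).
have e13 : x1 - x3 != 0 by rewrite subr_eq0.
have eq : l * (y1 + y2) - u * (y2 + y3) = q * (x1 - x3) by rewrite /q; field.
have ea : a = q - x1 - x2 - x3.
  apply: (mulIf e13); rewrite !mulrBl -eq; apply: eq0_sub.
  transitivity (b - b); last exact: subrr.
  by rewrite {1}gd2.2 gd.2; ring.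
have f1 : y1 = y2 + l * (x1 - x2) by rewrite gd.1; ring.
have ql : q != l ^+ 2.
  apply: contra d43 => /eqP E; rewrite /x4 ea E; apply/eqP; ring.
have qu : q != u ^+ 2.
  apply: contra d15 => /eqP E; rewrite /x5 ea E; apply/eqP; ring.
have eq' : 2 * (l - u) * y2 = q * (x1 - x3) - l ^+ 2 * (x1 - x2) + u ^+ 2 * (x3 - x2).
  by rewrite -eq f1 gd2.1; ring.
have lu : l != u.
  apply: contra ql => /eqP E; apply/eqP; apply: (mulIf e13).
  apply: eq0_sub; transitivity (2 * (l - u) * y2); last by rewrite E; ring.
  by rewrite eq' E; ring.
have := @gen_x x2 (x1 - x2) (x3 - x2) l u q lu ql qu.
have -> : q - 3 * x2 - (x1 - x2) - (x3 - x2) = a by rewrite ea; ring.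
have lu' : l - u != 0 by rewrite subr_eq0.
have -> : (q * (x1 - x2 - (x3 - x2)) - l ^+ 2 * (x1 - x2) + u ^+ 2 * (x3 - x2)) /
    (2 * (l - u)) = y2.
  have -> : x1 - x2 - (x3 - x2) = x1 - x3 by ring.
  by rewrite -eq'; field; rewrite h2 lu'.
have -> : x2 + (x1 - x2) = x1 by ring.
have -> : x2 + (x3 - x2) = x3 by ring.
rewrite -f1.
have -> : y2 + u * (x3 - x2) = y3 by rewrite gd2.1; ring.
by move=> /= ->.
Qed.
End ChordTangent.

(* y^2 = x^3 + a x^2 + b x + c has no singular point over an algebraic closure
   of the rationals; the point at infinity of such a cubic is never singular. *)
Definition nonsingular (a b c : int) : Prop :=
  forall x y : algC,
    y ^+ 2 = x ^+ 3 + a%:~R * x ^+ 2 + b%:~R * x + c%:~R ->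
    ~ (2 * y = 0 /\ 3 * x ^+ 2 + 2 * a%:~R * x + b%:~R = 0).

Record elliptic_curve := EllipticCurve {
  coef_a : int;
  coef_b : int;
  coef_c : int;
  curve_nonsingular : nonsingular coef_a coef_b coef_c }.

Section RationalPoints.
Variable E : elliptic_curve.
Local Notation a := ((coef_a E)%:~R : rat).
Local Notation b := ((coef_b E)%:~R : rat).
Local Notation c := ((coef_c E)%:~R : rat).

Record rational_point := RationalPoint {
  point_val : option (rat * rat);
  point_on_curve : on_curve a b c point_val }.

HB.instance Definition _ := [isSub for point_val].
HB.instance Definition _ := [Choice of rational_point by <:].

Lemma rat_two_neq0 : 2 != 0 :> rat. Proof. by []. Qed.

Lemma rat_nonsingular (x : rat) : x ^+ 3 + a * x ^+ 2 + b * x + c = 0 ->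
  3 * x ^+ 2 + 2 * a * x + b != 0.
Proof.
move=> e; apply/eqP => e'.
have [|] := @curve_nonsingular E (ratr x) 0.
  have := congr1 (ratr : rat -> algC) e.
  rewrite !(rmorphD, rmorphM, rmorphXn, rmorph0) /= !ratr_int => ->.
  by rewrite expr0n.
split; first by rewrite mulr0.
have := congr1 (ratr : rat -> algC) e'.
by rewrite !(rmorphD, rmorphM, rmorphXn, rmorph0, rmorph1) /= !ratr_int.
Qed.

Definition zero_rp := RationalPoint (isT : on_curve a b c None).
Definition opp_rp (P : rational_point) :=
  RationalPoint (cur_opp (point_on_curve P)).
Definition add_rp (P Q : rational_point) :=
  RationalPoint (cur_add rat_two_neq0 (point_on_curve P) (point_on_curve Q)).

Lemma add_rpA : associative add_rp.
Proof.
move=> [p hp] [q hq] [r hr]; apply: val_inj.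
exact: (addA rat_two_neq0 rat_nonsingular hp hq hr).
Qed.

Lemma add_rpC : commutative add_rp.
Proof. by move=> [p hp] [q hq]; apply: val_inj; exact: (addC rat_two_neq0 hp hq). Qed.

Lemma add_rp0 : left_id zero_rp add_rp.
Proof. by move=> [p hp]; apply: val_inj. Qed.

Lemma add_rpN : left_inverse zero_rp opp_rp add_rp.
Proof. by move=> [p hp]; apply: val_inj; exact: addN. Qed.

HB.instance Definition _ :=
  GRing.isZmodule.Build rational_point add_rpA add_rpC add_rp0 add_rpN.

Definition infinite_order (P : rational_point) : Prop :=
  forall j : nat, (0 < j)%N -> P *+ j <> 0.

Definition standard_coords (P : rational_point) (m n e : int) : Prop :=
  [/\ point_val P = Some (m%:~R / e%:~R ^+ 2, n%:~R / e%:~R ^+ 3),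
      1 <= e, gcdz m e = 1 & gcdz n e = 1].

Lemma standard_coords_ex (P : rational_point) : P != 0 ->
  exists m n e, standard_coords P m n e.
Proof.
case: P => [[[x y]|] hP] nz; last by move: nz; rewrite -val_eqE.
move/eqP: (hP) => {nz} /= h.
pose q := denq x; pose s := denq y; pose p := numq x; pose r := numq y.
have q0 : q%:~R != 0 :> rat by rewrite intr_eq0 denq_neq0.
have s0 : s%:~R != 0 :> rat by rewrite intr_eq0 denq_neq0.
pose N := p ^+ 3 + q * (coef_a E * p ^+ 2 + coef_b E * p * q + coef_c E * q ^+ 2).
have eN : r ^+ 2 * q ^+ 3 = N * s ^+ 2.
  apply: (@intr_inj rat); rewrite /N !(rmorphD, rmorphM, rmorphXn) /=.
  have hx : x = p%:~R / q%:~R by rewrite divq_num_den.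
  have hy : y = r%:~R / s%:~R by rewrite divq_num_den.
  have -> : r%:~R ^+ 2 * q%:~R ^+ 3 = y ^+ 2 * s%:~R ^+ 2 * q%:~R ^+ 3 :> rat.
    by rewrite hy; field.
  by rewrite h hx; field.
have cpq : coprimez p q by rewrite coprimezE coprime_num_den.
have crs : coprimez r s by rewrite coprimezE coprime_num_den.
have cNq : coprimez N q.
  rewrite coprimez_sym /N addrC [q * _]mulrC /coprimez gcdzMDl.
  by apply: (@coprimezXr 3); rewrite coprimez_sym.
have csr : coprimez (s ^+ 2) (r ^+ 2).
  by apply/coprimezXl/coprimezXr; rewrite coprimez_sym.
have cqN : coprimez (q ^+ 3) N by apply: coprimezXl; rewrite coprimez_sym.
have e1 : (s ^+ 2 %| q ^+ 3)%Z by rewrite -(Gauss_dvdzr _ csr) eN dvdz_mull.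
have e2 : (q ^+ 3 %| s ^+ 2)%Z by rewrite -(Gauss_dvdzr _ cqN) -eN dvdz_mull.
have qs : q ^+ 3 = s ^+ 2.
  have := denq_ge0 x; have := denq_ge0 y; rewrite -/q -/s => s_ge0 q_ge0.
  rewrite -[LHS]gez0_abs ?exprn_ge0 // -[RHS]gez0_abs ?exprn_ge0 //.
  by congr Posz; apply/eqP; rewrite eqn_dvd; apply/andP.
have /dvdzP[e es] : (q %| s)%Z.
  have : (q ^+ 2 %| s ^+ 2)%Z by rewrite -qs exprS dvdz_mull.
  by rewrite !dvdzE !abszX dvdn_pexp2r.
have qn0 : q != 0 by rewrite denq_neq0.
have eq : q = e ^+ 2.
  apply: (mulfI (expf_neq0 2 qn0)); rewrite -exprSr qs es; ring.
have e_gt0 : 0 < e.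
  by have := denq_gt0 y; rewrite -/s es pmulr_lgt0 // denq_gt0.
have es3 : s = e ^+ 3 by rewrite es eq; ring.
exists p, r, e; split=> /=.
- rewrite -!rmorphXn /= -eq -es3.
  by congr (Some (_, _)); rewrite divq_num_den.
- by rewrite -gtz0_ge1.
- by apply/eqP; move: cpq; rewrite eq coprimez_pexpr.
- by apply/eqP; move: crs; rewrite es3 coprimez_pexpr.
Qed.

End RationalPoints.

(* [e k] stands for e_k, attached to the multiple 2^k P. *)
Definition Fquot (e : nat -> int) (k : nat) : rat :=
  if k is k'.+1 then (e k)%:~R / (e k')%:~R else (e 0%N)%:~R.

(* Main.v *)
Require Import Defs.
From mathcomp Require Import all_boot all_order all_algebra all_field.
From mathcomp Require Import ring.
Import GRing.Theory Num.Theory.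
Local Open Scope ring_scope.

(** With 2^(k-1) P = (m / e^2, n / e^3), the tangent at this point has slope
    L / (2 n e) for an integer L, so x(2^k P) = N / (2 n e)^2 for an integer N.
    As this fraction equals m' / e'^2 in lowest terms, e'^2 divides (2 n e)^2,
    hence e' divides 2 n e, and 2 n / (e' / e) = 2 n e / e'. *)

Lemma doubling_denominator_dvd {E : elliptic_curve} {Q : rational_point E}
    {m n e m' n' e' : int} :
  standard_coords Q m n e -> standard_coords (Q + Q) m' n' e' ->
  (e' %| 2 * n * e)%Z.
Proof.
case=> hQ e_ge1 _ _ [hQQ e'_ge1 cop _].
have e0 : e%:~R != 0 :> rat by rewrite intr_eq0 lt0r_neq0.
have e'0 : e'%:~R != 0 :> rat by rewrite intr_eq0 lt0r_neq0.
have : add_pt (coef_a E)%:~R (coef_b E)%:~R (point_val Q) (point_val Q) =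
    Some (m'%:~R / e'%:~R ^+ 2, n'%:~R / e'%:~R ^+ 3) := hQQ.
(* The branch [y = - y] would make [Q + Q] the point at infinity, but [Q + Q] has affine
   coordinates. *)
rewrite hQ /= eqxx /=; case: eqP => // yN [+ _].
have n0 : n%:~R != 0 :> rat.
  by apply/eqP => n0; apply: yN; rewrite n0 mul0r oppr0.
rewrite /slope eqxx => hx.
(* [L] is [e ^+ 4] times the numerator of the tangent slope; [N] is [slope ^+ 2 - a - 2 * x] times
   [(2 * n * e) ^+ 2]. *)
pose L := 3 * m ^+ 2 + 2 * coef_a E * m * e ^+ 2 + coef_b E * e ^+ 4.
pose N := L ^+ 2 - 4 * n ^+ 2 * (coef_a E * e ^+ 2 + 2 * m).
(* The two fractions for the abscissa of [Q + Q], cross-multiplied to an identity in integers. *)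
have key : m' * (2 * n * e) ^+ 2 = e' ^+ 2 * N.
  apply: (@intr_inj rat).
  have -> : (m' * (2 * n * e) ^+ 2)%:~R =
      m'%:~R / e'%:~R ^+ 2 * (2 * n * e)%:~R ^+ 2 * e'%:~R ^+ 2 :> rat.
    by rewrite !(rmorphM, rmorphXn) /=; field.
  rewrite -hx /N /L !(rmorphD, rmorphB, rmorphN, rmorphM, rmorphXn) /=.
  by field; rewrite n0 e0.
have cop2 : coprimez (e' ^+ 2) m'.
  by apply: coprimezXl; rewrite coprimez_sym; apply/eqP.
have : (e' ^+ 2 %| (2 * n * e) ^+ 2)%Z.
  by rewrite -(Gauss_dvdzr _ cop2) key dvdz_mulr.
by rewrite !dvdzE !abszX dvdn_pexp2r.
Qed.

Theorem theorem1p7 (E : elliptic_curve) (P : rational_point E)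
    (hP : infinite_order P) (m n e : nat -> int)
    (hmne : forall k : nat, standard_coords (P *+ 2 ^ k) (m k) (n k) (e k))
    (k : nat) (hk : (1 <= k)%N) :
  (2 * n k.-1)%:~R / Fquot e k \is a Num.int.
Proof.
case: k hk => // k _ /=.
(* With the index shifted to [k.+1], the point is the double of [P *+ 2 ^ k]. *)
have hd := hmne k.+1; rewrite expnSr mulrnA mulr2n in hd.
have /dvdzP[t ht] := doubling_denominator_dvd (hmne k) hd.
have [_ e'_ge1 _ _] := hd.
have e'0 : (e k.+1)%:~R != 0 :> rat by rewrite intr_eq0 lt0r_neq0.
(* The cofactor [t] in [2 * n k * e k = t * e k.+1] is the required integer. *)
suff -> : (2 * n k)%:~R / ((e k.+1)%:~R / (e k)%:~R) = t%:~R :> rat.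
  exact: intr_int.
by rewrite invfM invrK mulrCA mulrC -intrM ht intrM mulfK.
Qed.
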